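(* Let $\mathbf{p}$ be a planar rational parametric curve of degree $n$ in homogeneous form, let $(q_k)_{k=1}^M$ be a basis for the implicit polynomials of degree $m$, and let $\langle f,g\rangle_w=\int_\Omega w(t)f(t)g(t)\,dt$ be a weighted $L^2$-inner product on $\Omega=[0,1]$. Let $\bm{\alpha}=(\alpha_j)_{j=1}^{L}$, $L=mn+1$, be a basis of the space of real univariate polynomials of degree at most $mn$ which is orthonormal with respect to $\langle\cdot,\cdot\rangle_w$, i.e. $\langle\alpha_i,\alpha_j\rangle_w=\delta_{ij}$ for all $i,j=1,\dots,L$. Let $\mathbf{D}_\alpha=(d_{j,k})\in\mathbb{R}^{L\times M}$ be the matrix determined by $q_k(\mathbf{p}(t))=\sum_{j=1}^L d_{j,k}\alpha_j(t)$ for $k=1,\dots,M$, and let $\mathbf{M}_w=(m_{k,l})\in\mathbb{R}^{M\times M}$ be given by $m_{k,l}=\langle q_k\circ\mathbf{p},\,q_l\circ\mathbf{p}\rangle_w$. Then $$\mathbf{M}_w=\mathbf{D}_\alpha^T\mathbf{D}_\alpha .$$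
   Context: A planar rational parametric curve of degree $n$ is represented in homogeneous form as $\mathbf{p}(t)=(g_1(t),g_2(t),h(t))$, where $g_1,g_2,h$ are real polynomials of degree at most $n$, with parameter domain $\Omega=[0,1]$. The implicit basis $(q_k)_{k=1}^M$, $M=\binom{m+2}{2}$, is a fixed basis of the homogeneous polynomials of degree $m$ in three variables $u,v,w$ (by default the Bernstein basis $\binom{m}{k_1,k_2,k_3}u^{k_1}v^{k_2}w^{k_3}$, $k_1+k_2+k_3=m$, ordered lexicographically). Thus each $q_k\circ\mathbf{p}$ is a univariate polynomial of degree at most $mn$. The function $w(t)$ in the inner product is a weight function on $\Omega$ such that $\langle\cdot,\cdot\rangle_w$ is a (well-defined) inner product on real polynomials. *)

(* Defs.v *)
From HB Require Import structures.
From mathcomp Require Import all_boot all_order all_algebra.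
From mathcomp Require Import all_classical all_reals all_analysis.
(* The notations of multinomials and of mathcomp-analysis are incompatible. *)
From mathcomp Require Import -(notations) mpoly.

Set Implicit Arguments.
Unset Strict Implicit.
Unset Printing Implicit Defensive.

Import Order.TTheory GRing.Theory Num.Theory.
Import numFieldNormedType.Exports.

Local Open Scope classical_set_scope.
Local Open Scope ring_scope.

(* q o p, where p = (g1, g2, h) is substituted for (u, v, w). *)
Definition comp_curve (R : realType) (p : 3.-tuple {poly R})
    (q : mpoly 3 R) : {poly R} :=
  mmap (@polyC R) (tnth p) q.

Lemma horner_comp_curve (R : realType) (p : 3.-tuple {poly R}) (q : mpoly 3 R)
    (t : R) :
  (comp_curve p q).[t] = meval (fun i => (tnth p i).[t]) q.
Proof.
rewrite /comp_curve /meval /mmap horner_sum; apply: eq_bigr => mo _.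
rewrite hornerM hornerC /mmap1 horner_prod; congr (_ * _).
by apply: eq_bigr => i _; rewrite horner_exp.
Qed.

Definition wdot (R : realType) (w : R -> R) (f g : {poly R}) : R :=
  \int[@lebesgue_measure R]_(t in `[0, 1]) (w t * f.[t] * g.[t]).

Definition is_inner_product (R : realType) (ip : {poly R} -> {poly R} -> R) :=
  [/\ forall f g, ip f g = ip g f,
      forall g, scalar (ip^~ g)
    & forall f, f != 0 -> 0 < ip f f].

(* Integrals are total functions here, so the well-definedness of wdot has to
   be required explicitly. *)
Definition is_weight (R : realType) (w : R -> R) : Prop :=
  (forall f g : {poly R},
     (@lebesgue_measure R).-integrable `[0, 1]
       (fun t => (w t * f.[t] * g.[t])%:E)) /\
  is_inner_product (wdot w).

Definition gram_matrix (R : realType) (w : R -> R) (M : nat)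
    (f : 'I_M -> {poly R}) : 'M[R]_M :=
  \matrix_(k, l) wdot w (f k) (f l).

(* Main.v *)
Require Import Defs.
From mathcomp Require Import all_boot all_order all_algebra.
From mathcomp Require Import all_classical all_reals all_analysis.
From mathcomp Require Import -(notations) mpoly.

Import Order.TTheory GRing.Theory Num.Theory.
Local Open Scope ring_scope.

Lemma scalar_sumZ (R : pzRingType) (V : lmodType R) (f : V -> R) (I : Type)
    (r : seq I) (P : pred I) (a : I -> R) (v : I -> V) :
  scalar f ->
  f (\sum_(i <- r | P i) a i *: v i) = \sum_(i <- r | P i) a i * f (v i).
Proof.
move=> fL.
have f0 : f 0 = 0.
  by have := fL (-1) 0 0; rewrite scaler0 addr0 mulN1r addNr.
elim/big_rec2: _ => [|i y x _ <-]; first exact: f0.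
exact: fL.
Qed.

Lemma inner_product_orthonormal_sum (R : realType)
    (ip : {poly R} -> {poly R} -> R) (L : nat) (alpha : 'I_L -> {poly R})
    (a b : 'I_L -> R) :
  is_inner_product ip ->
  (forall i j, ip (alpha i) (alpha j) = (i == j)%:R) ->
  ip (\sum_j a j *: alpha j) (\sum_j b j *: alpha j) = \sum_j a j * b j.
Proof.
move=> [ipC ipL _] orth.
rewrite (scalar_sumZ _ _ _ _ _ _ _ _ (ipL _)); apply: eq_bigr => i _; congr (_ * _).
rewrite ipC (scalar_sumZ _ _ _ _ _ _ _ _ (ipL _)) (bigD1 i) //= orth eqxx mulr1.
by rewrite big1 ?addr0 // => j /negPf ji; rewrite orth ji mulr0.
Qed.

Theorem theorem1 (R : realType) (n m : nat) (w : R -> R) (hw : is_weight w)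
    (p : 3.-tuple {poly R}) (hp : forall i : 'I_3, (size (tnth p i) <= n.+1)%N)
    (q : 'C(m + 2, 2).-tuple (dhomog 3 R m))
    (hq : basis_of (fullv : {vspace (dhomog 3 R m)}) q)
    (alpha : (m * n + 1).-tuple {poly_(m * n + 1) R})
    (halpha : basis_of (fullv : {vspace {poly_(m * n + 1) R}}) alpha)
    (horth : forall i j : 'I_(m * n + 1),
       wdot w (tnth alpha i) (tnth alpha j) = (i == j)%:R)
    (D : 'M[R]_(m * n + 1, 'C(m + 2, 2)))
    (hD : forall k : 'I_('C(m + 2, 2)),
       comp_curve p (mpoly_of_dhomog (tnth q k)) =
         \sum_(j < m * n + 1) D j k *: (tnth alpha j : {poly R})) :
  gram_matrix w (fun k => comp_curve p (mpoly_of_dhomog (tnth q k))) =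
    D^T *m D.
Proof.
case: hw => _ ip_w; apply/matrixP => k l; rewrite !mxE !hD.
rewrite (inner_product_orthonormal_sum _ _ _ _ _ _ ip_w horth).
by apply: eq_bigr => j _; rewrite mxE.
Qed.
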